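(* Assume $\{a_j\}_{j\in\mathbb{Z}}$ to be a nonnegative sequence such that $a_j = 1 + \mathrm{D}_+b_j$ with $\mathrm{D}_+b \in \boldsymbol{\ell}^2$. Then, for any given index $i$, there exists a unique sequence $g_i = \{g_{i,j}\}_{j\in\mathbb{Z}}$ such that $$(\mathrm{A}[a]g_i)_j = \frac{\delta_{i,j}}{\Delta\xi}.$$
   Context: Fix a grid step $\Delta\xi>0$. For a real sequence $v=\{v_j\}_{j\in\mathbb{Z}}$ put $\mathrm{D}_{\pm}v_j := \pm (v_{j\pm1}-v_j)/\Delta\xi$. Let $\boldsymbol{\ell}^2$ be the space of sequences with $\|v\|_{\boldsymbol{\ell}^2} = (\Delta\xi\sum_{j\in\mathbb{Z}}|v_j|^2)^{1/2}<\infty$, and $\boldsymbol{\ell}^\infty$ the space of bounded sequences with the supremum norm. Here $b=\{b_j\}_{j\in\mathbb{Z}}$ is a real sequence, and $\delta_{i,j}$ is the Kronecker delta, equal to one when the indices coincide and zero otherwise. For a given sequence $a=\{a_j\}_{j\in\mathbb{Z}}\in\boldsymbol{\ell}^\infty$ and an arbitrary sequence $w=\{w_j\}_{j\in\mathbb{Z}}\in\boldsymbol{\ell}^2$, the operator $\mathrm{A}[a]:\boldsymbol{\ell}^2\to\boldsymbol{\ell}^2$ is defined by $$(\mathrm{A}[a]w)_j := a_jw_j - \mathrm{D}_-\left(\frac{\mathrm{D}_+w_j}{a_j}\right),\qquad j\in\mathbb{Z}.$$ Since $a_j=0$ is allowed, the equation $\mathrm{A}[a]w=f$ is understood as the first-order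 system: there is a sequence $\gamma=\{\gamma_j\}_{j\in\mathbb{Z}}$ with $\mathrm{D}_+w_j = a_j\gamma_j$ and $a_jw_j-\mathrm{D}_-\gamma_j = f_j$ for all $j\in\mathbb{Z}$ (so $\gamma_j=\mathrm{D}_+w_j/a_j$ whenever $a_j>0$). *)

(* Defs.v *)
From HB Require Import structures.
From mathcomp Require Import all_boot all_order all_algebra.
From mathcomp Require Import all_classical all_reals all_analysis.

Set Implicit Arguments.
Unset Strict Implicit.
Unset Printing Implicit Defensive.

Import Order.TTheory GRing.Theory Num.Theory.

Local Open Scope ring_scope.

Definition Dplus (R : realType) (dxi : R) (v : int -> R) : int -> R :=
  fun j => (v (j + 1) - v j) / dxi.

Definition Dminus (R : realType) (dxi : R) (v : int -> R) : int -> R :=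
  fun j => - ((v (j - 1) - v j) / dxi).

Definition l2norm (R : realType) (dxi : R) (v : int -> R) : \bar R :=
  sqrte (dxi%:E * \esum_(j in [set: int]) ((`|v j| ^+ 2)%:E))%E.

Definition ell2 (R : realType) (dxi : R) : set (int -> R) :=
  [set v | (l2norm dxi v < +oo)%E].

(* The equation A[a] w = f.  The coefficient a may vanish, so the quotient
   (D_+ w)_j / a_j is represented by an auxiliary sequence gamma, on which no
   summability is imposed.  See [Aeq_nonvanishing] for the case without zeros. *)
Definition Aeq (R : realType) (dxi : R) (a w f : int -> R) : Prop :=
  exists gamma : int -> R, forall j : int,
    Dplus dxi w j = a j * gamma j /\
    a j * w j - Dminus dxi gamma j = f j.

Lemma Aeq_nonvanishing (R : realType) (dxi : R) (a w f : int -> R) :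
  (forall j, a j != 0) ->
  Aeq dxi a w f <->
  (forall j, a j * w j - Dminus dxi (fun k => Dplus dxi w k / a k) j = f j).
Proof.
move=> a0; split=> [[g Hg] j|H].
  have <- : g = (fun k => Dplus dxi w k / a k).
    by apply/funext => k; have [-> _] := Hg k; rewrite mulrAC divff ?mul1r.
  by have [] := Hg j.
exists (fun k => Dplus dxi w k / a k) => j; split; last exact: H.
by rewrite mulrCA divff ?mulr1.
Qed.

(* Main.v *)
(** The first-order system is a nonnegative three-term recurrence
    [x (n + 2) = x n + c n * x (n + 1)] for the interleaved sequence
    [gamma (j - 1), w j, gamma j, w (j + 1), ...].  On a half-line it has a
    solution with alternating signs, whose moduli are nonincreasing along each
    parity; telescoping the product of consecutive terms gives
    square-summability, because [a] tends to [1].  Gluing the two half-line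
    solutions at [i] with the right jump of [gamma] yields existence.  For
    uniqueness, [gamma (j - 1) * w j] is nondecreasing for a homogeneous
    solution and tends to [0] at both ends, hence vanishes identically. *)

Require Import Defs.
From HB Require Import structures.
From mathcomp Require Import all_boot all_order all_algebra.
From mathcomp Require Import all_classical all_reals all_analysis.
From mathcomp Require Import ring lra zify.

Set Implicit Arguments.
Unset Strict Implicit.

Import Order.TTheory GRing.Theory Num.Theory.
Import numFieldNormedType.Exports.

Local Open Scope classical_set_scope.
Local Open Scope ring_scope.

(** * Square-summable sequences over the integers *)

Lemma ell2E (R : realType) (dxi : R) (v : int -> R) : 0 < dxi ->
  ell2 dxi v <-> (\esum_(j in [set: int]) (`|v j| ^+ 2)%:E < +oo)%E.
Proof.
move=> h0; rewrite /ell2 /= /l2norm.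
have : (0 <= \esum_(j in [set: int]) (`|v j| ^+ 2)%:E)%E.
  by apply: esum_ge0 => j _; rewrite lee_fin exprn_ge0.
case: (\esum_(j in _) _) => [r| |] //= _; first by split => _; rewrite ltry.
by rewrite gt0_muley ?lte_fin.
Qed.

(** Along an injection the squares form a series bounded by the full sum, so its terms tend to 0.
    Quantifying over injections covers both ends of the integers and all shifts at once. *)
Lemma ell2_cvg0 (R : realType) (dxi : R) (v : int -> R) (s : nat -> int) :
  0 < dxi -> ell2 dxi v -> injective s -> (v (s n) @[n --> \oo] --> 0).
Proof.
move=> h0 /(ell2E _ h0) vfin sinj.
set S := (\esum_(j in _) _)%E in vfin.
have S0 : (0 <= S)%E by apply: esum_ge0 => j _; rewrite lee_fin exprn_ge0.
have Sub n : (\sum_(0 <= k < n) (`|v (s k)| ^+ 2)%:E <= S)%E.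
  apply: (@le_trans _ _ (\sum_(0 <= k <oo) (`|v (s k)| ^+ 2)%:E)%E).
    by apply: nneseries_lim_ge => k _ _; rewrite lee_fin exprn_ge0.
  rewrite nneseries_esumT; last by move=> k; rewrite lee_fin exprn_ge0.
  rewrite -(@esum_image R _ _ [set: nat] s (fun j => (`|v j| ^+ 2)%:E)); last first.
    by move=> x y _ _; exact: sinj.
  rewrite esum_mkcond; apply: le_esum => j _; case: ifP => _; first exact: lexx.
  by rewrite lee_fin exprn_ge0.
have Sfin : S \is a fin_num by rewrite ge0_fin_numE.
have cv : cvgn (series (fun k => `|v (s k)| ^+ 2)).
  apply: nondecreasing_is_cvgn.
    by apply: nondecreasing_series => k _ _; rewrite exprn_ge0.
  exists (fine S) => _ [n _ <-].
  by rewrite /series /= -lee_fin fineK // -sumEFin.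
have /cvgrPdist_lt c0 := cvg_series_cvg_0 cv.
apply/cvgrPdist_lt => e e0.
have := c0 _ (exprn_gt0 2 e0); apply: filterS => n /=.
rewrite !sub0r !normrN ger0_norm ?exprn_ge0 // => lt.
by rewrite -(@ltr_pXn2r _ 2%N) // nnegrE ?normr_ge0 // ltW.
Qed.

Lemma esum_nat_le (R : realType) (f : nat -> R) (M : R) :
  (forall k, 0 <= f k) -> (forall n, \sum_(0 <= k < n) f k <= M) ->
  (\esum_(k in [set: nat]) (f k)%:E <= M%:E)%E.
Proof.
move=> f0 fM; rewrite -nneseries_esumT => [|k]; last by rewrite lee_fin.
apply: lime_le; first by apply: is_cvg_nneseries => k _ _; rewrite lee_fin.
by apply: nearW => n; rewrite sumEFin lee_fin.
Qed.

Lemma ell2_two_sided (R : realType) (dxi : R) (v : int -> R) (i : int) (M M' : R) :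
  0 < dxi ->
  (forall n, \sum_(0 <= k < n) v (i + k%:Z) ^+ 2 <= M) ->
  (forall n, \sum_(0 <= k < n) v (i - k.+1%:Z) ^+ 2 <= M') ->
  ell2 dxi v.
Proof.
move=> h0 HM HM'; apply/ell2E => //.
pose B := [set j : int | i <= j].
rewrite (esumID B) => [|j _]; last by rewrite lee_fin exprn_ge0.
rewrite !setTI.
have -> : B = (fun k : nat => i + k%:Z) @` [set: nat].
  apply/seteqP; split => [j /= ij|_ [k _ <-]]; last by rewrite /B /= lerDl.
  by exists `|j - i|%N => //; rewrite /B /= in ij; lia.
have -> : ~` ((fun k : nat => i + k%:Z) @` [set: nat]) =
    (fun k : nat => i - k.+1%:Z) @` [set: nat].
  apply/seteqP; split => [j /= ij|_ [k _ <-]].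
    exists `|j - i|.-1%N => //.
    have : ~ (i <= j) by move=> le; apply: ij; exists `|j - i|%N => //; lia.
    lia.
  by case=> m _; lia.
rewrite esum_image => [|x y _ _ /=]; last by lia.
rewrite esum_image => [|x y _ _ /=]; last by lia.
apply: (@le_lt_trans _ _ (M%:E + M'%:E)%E); last by rewrite -EFinD ltry.
apply: leeD; apply: esum_nat_le => k; rewrite ?exprn_ge0 //.
- by under eq_bigr do rewrite real_normK ?num_real //.
- by under eq_bigr do rewrite real_normK ?num_real //.
Qed.

(** * Three-term recurrences and decaying half-line solutions *)

(** The plus sign preserves nonnegativity; multiplying by [(-1) ^+ n] gives solutions of the
    recurrence with a minus sign. *)
Fixpoint three_term (R : realType) (c : nat -> R) (x0 x1 : R) (n : nat) : R :=
  if n is n1.+1 then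
    if n1 is n2.+1 then three_term c x0 x1 n2 + c n2 * three_term c x0 x1 n1
    else x1
  else x0.

Lemma three_termSS (R : realType) (c : nat -> R) (x0 x1 : R) (n : nat) :
  three_term c x0 x1 n.+2 =
  three_term c x0 x1 n + c n * three_term c x0 x1 n.+1.
Proof. by []. Qed.

Lemma three_term_ge0 (R : realType) (c : nat -> R) (x0 x1 : R) (n : nat) :
  (forall n, 0 <= c n) -> 0 <= x0 -> 0 <= x1 -> 0 <= three_term c x0 x1 n.
Proof.
move=> c0 h0 h1.
suff: 0 <= three_term c x0 x1 n /\ 0 <= three_term c x0 x1 n.+1 by case.
elim: n => [//|n [IH0 IH1]]; split=> //.
by rewrite three_termSS addr_ge0 ?mulr_ge0.
Qed.

(** As a function of [d] the expression obeys a shifted copy of the recurrence, with value 0 at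
    [d = 0] and 1 at [d = 1], so nonnegativity propagates. *)
Lemma casoratian_ge0 (R : realType) (c : nat -> R) (n d : nat) :
  (forall n, 0 <= c n) ->
  0 <= (-1) ^+ n * (three_term c 1 0 n * three_term c 0 1 (n + d) -
                    three_term c 1 0 (n + d) * three_term c 0 1 n).
Proof.
move=> c0; set P := three_term c 1 0; set Q := three_term c 0 1.
pose E d := (-1) ^+ n * (P n * Q (n + d)%N - P (n + d)%N * Q n).
suff: 0 <= E d /\ 0 <= E d.+1 by case.
elim: d => [|d [IH0 IH1]]; split=> //.
- by rewrite /E addn0 subrr mulr0.
- rewrite /E addn1 => {E}.
  suff -> : (-1) ^+ n * (P n * Q n.+1 - P n.+1 * Q n) = 1 by [].
  elim: n => [|n IH]; first by rewrite /P /Q /=; ring.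
  by rewrite -[RHS]IH /P /Q !three_termSS exprS; ring.
- have -> : E d.+2 = E d + c (n + d)%N * E d.+1.
    by rewrite /E !addnS /P /Q !three_termSS; ring.
  apply: addr_ge0 => //; apply: mulr_ge0 => //.
Qed.

(* With [P], [Q] the fundamental solutions, [(-1) ^+ n * (P n - s * Q n)] is
   nonnegative for all [n] iff [s] separates the ratios [P / Q] at odd indices
   from those at even indices; the Casoratian shows that these are ordered. *)
Lemma recessive_solution (R : realType) (c : nat -> R) :
  (forall n, 0 <= c n) -> (exists k, 0 < c k.*2) ->
  exists y : nat -> R,
    [/\ y 0%N = 1, forall n, 0 <= y n &
        forall n, y n.+2 = y n - c n * y n.+1].
Proof.
move=> c0 [K cK].
pose P := three_term c 1 0; pose Q := three_term c 0 1.
have P0 n : 0 <= P n by exact: three_term_ge0.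
have Q0 n : 0 <= Q n by exact: three_term_ge0.
have Qodd k : 0 < Q k.*2.+1.
  elim: k => [|k IH]; first exact: ltr01.
  by rewrite doubleS /Q three_termSS ltr_wpDr // mulr_ge0 // Q0.
have cross j k : P j.*2.+1 * Q k.*2 <= P k.*2 * Q j.*2.+1.
  have [le|lt] := leqP k.*2 j.*2.+1.
    have := casoratian_ge0 k.*2 (j.*2.+1 - k.*2)%N c0.
    by rewrite subnKC // -signr_odd odd_double mul1r subr_ge0.
  have := casoratian_ge0 j.*2.+1 (k.*2 - j.*2.+1)%N c0.
  rewrite subnKC; last exact: ltnW.
  by rewrite -signr_odd /= odd_double /= mulN1r opprB subr_ge0.
pose S := range (fun j => P j.*2.+1 / Q j.*2.+1).
have ubS k : 0 < Q k.*2 -> ubound S (P k.*2 / Q k.*2).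
  move=> Qk _ [j _ <-].
  by rewrite ler_pdivrMr // mulrAC ler_pdivlMr.
(* The positive coefficient yields a positive denominator at an even index, so an even ratio bounds
   [S] above. *)
have QK : 0 < Q K.+1.*2.
  by rewrite doubleS /Q three_termSS ltr_wpDl ?mulr_gt0 //.
have S0 : S !=set0 by exists (P 1%N / Q 1%N); exists 0%N.
have hsS : has_sup S by split => //; exists (P K.+1.*2 / Q K.+1.*2); exact: ubS.
exists (fun n => (-1) ^+ n * (P n - sup S * Q n)); split.
- by rewrite /P /Q /= ; ring.
- move=> n; rewrite -signr_odd -{2 3}(odd_double_half n).
  case: (odd n) => /=; rewrite ?add1n ?add0n.
    rewrite expr1 mulN1r opprB subr_ge0 -ler_pdivrMr //.
    by apply: sup_upper_bound => //; exists n./2.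
  rewrite mul1r subr_ge0.
  have [Qz|Qn] := eqVneq (Q n./2.*2) 0; first by rewrite Qz mulr0.
  have Qp : 0 < Q n./2.*2 by rewrite lt_def Qn Q0.
  by rewrite -ler_pdivlMr //; apply: ge_sup => //; exact: ubS.
- by move=> n; rewrite /P /Q !three_termSS !exprS; ring.
Qed.

(* [y n * y n.+1 - y n.+1 * y n.+2 = c n * y n.+1 ^+ 2] *)
Lemma recessive_square_summable (R : realType) (c y : nat -> R) (e : R) (N : nat) :
  0 < e -> (forall n, (N <= n)%N -> e <= c n) -> (forall n, 0 <= y n) ->
  (forall n, y n.+2 = y n - c n * y n.+1) ->
  exists M : R, forall n, \sum_(0 <= k < n) y k ^+ 2 <= M.
Proof.
move=> e0 ce y0 yr.
have tele n : e * \sum_(0 <= k < n) y (N.+1 + k)%N ^+ 2 <=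
    y N * y N.+1 - y (N + n)%N * y (N + n).+1.
  elim: n => [|n IH]; first by rewrite big_nil addn0 subrr mulr0.
  rewrite big_nat_recr //= mulrDr.
  have : e * y (N + n).+1 ^+ 2 <= c (N + n)%N * y (N + n).+1 ^+ 2.
    by rewrite ler_wpM2r ?sqr_ge0 // ce // leq_addr.
  by rewrite addSn addnS yr; move: IH; lra.
(* The first [N.+1] squares are kept; the telescoped bound, without its subtracted product, controls
   the rest. *)
exists (\sum_(0 <= k < N.+1) y k ^+ 2 + (y N * y N.+1) / e) => n.
apply: (@le_trans _ _ (\sum_(0 <= k < N.+1 + n) y k ^+ 2)).
  rewrite (@big_cat_nat _ _ _ n 0 (N.+1 + n)) //=; last exact: leq_addl.
  by rewrite lerDl sumr_ge0 // => k _; rewrite sqr_ge0.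
rewrite (@big_cat_nat _ _ _ N.+1 0 (N.+1 + n)) //=; last exact: leq_addr.
rewrite lerD2l ler_pdivlMr // mulrC.
rewrite -{1}[N.+1]add0n big_addn addKn.
under eq_bigr do rewrite addnC.
by apply: (le_trans (tele n)); rewrite gerBl mulr_ge0.
Qed.

(** [u] and [v] are the even and odd terms of a recessive solution for the interleaved coefficients.
    Positivity of [v 0] later keeps the normalizing constant at the source nonzero. *)
Lemma half_line_solution (R : realType) (p q : nat -> R) (e : R) (N : nat) :
  (forall k, 0 <= p k) -> (forall k, 0 <= q k) -> 0 < e ->
  (forall k, (N <= k)%N -> e <= p k) -> (forall k, (N <= k)%N -> e <= q k) ->
  exists u v : nat -> R,
    [/\ u 0%N = 1, 0 < v 0%N, forall k, u k.+1 = u k - p k * v k,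
        forall k, v k.+1 = v k - q k * u k.+1 &
        exists M, forall n, \sum_(0 <= k < n) u k ^+ 2 <= M].
Proof.
move=> p0 q0 e0 pe qe.
pose c n := if odd n then q n./2 else p n./2.
have c0 n : 0 <= c n by rewrite /c; case: ifP.
have ce n : (N.*2 <= n)%N -> e <= c n.
  move=> le; have le' : (N <= n./2)%N by lia.
  by rewrite /c; case: ifP => _; [exact: qe|exact: pe].
have c_even k : c k.*2 = p k by rewrite /c odd_double doubleK.
have c_odd k : c k.*2.+1 = q k by rewrite /c /= odd_double /= uphalf_double.
have [] := @recessive_solution R c c0.
  by exists N; rewrite (lt_le_trans e0) // ce.
move=> y [y1 y0 yr].
have [M HM] := recessive_square_summable e0 ce y0 yr.
exists (fun k => y k.*2), (fun k => y k.*2.+1); split => //.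
(* If [y 1] vanished, nonnegativity would force all odd terms to be 0, all even terms to be 1 and
   each [q k] to be 0, against [e <= q N]. *)
- rewrite lt_def y0 andbT; apply/eqP => /= yz.
  have cst k : y k.*2 = 1 /\ y k.*2.+1 = 0.
    elim: k => [//|k [IH0 IH1]].
    have E : y k.+1.*2 = 1 by rewrite doubleS yr IH0 IH1 mulr0 subr0.
    split => //; have := y0 k.+1.*2.+1; rewrite doubleS yr -doubleS E IH1.
    rewrite c_odd; have := q0 k; lra.
  have := y0 N.*2.+3; rewrite yr -doubleS (cst N).2 (cst N.+1).1 c_odd.
  have := qe N (leqnn N); lra.
- by move=> k; rewrite doubleS yr c_even.
- by move=> k; rewrite doubleS yr c_odd.
- exists M => n; apply: le_trans (HM n.*2).
  elim: n => [|n IH]; first by rewrite !big_nil.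
  rewrite doubleS !big_nat_recr //=.
  have := sqr_ge0 (y n.*2.+1); lra.
Qed.

(** * Uniqueness for the homogeneous system *)

(** By monotonicity each value lies between the limits at the two ends, both 0. *)
Lemma nondecreasing_int_vanish (R : realType) (x : int -> R) :
  (forall j, x j <= x (j + 1)) ->
  (forall s : nat -> int, injective s -> x (s n) @[n --> \oo] --> 0) ->
  forall j, x j = 0.
Proof.
move=> xmon x0 j.
have mon k (n : nat) : x k <= x (k + n%:Z).
  elim: n => [|n IH]; first by rewrite addr0.
  by rewrite -addn1 PoszD addrA (le_trans IH).
apply/eqP; rewrite eq_le; apply/andP; split.
- have inj : injective (fun n : nat => j + n%:Z) by move=> m n; lia.
  have c := x0 _ inj.
  rewrite -(cvg_lim _ c) //; apply: limr_ge; first by apply/cvg_ex; exists 0.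
  by apply: nearW => n; exact: mon.
- have inj : injective (fun n : nat => j - n%:Z) by move=> m n; lia.
  have c := x0 _ inj.
  rewrite -(cvg_lim _ c) //; apply: limr_le; first by apply/cvg_ex; exists 0.
  by apply: nearW => n; have := mon (j - n%:Z) n; rewrite subrK.
Qed.

(* [gamma (j - 1) * w j] is nondecreasing: its increment is
   [dxi * a j * (w j ^+ 2 + gamma j ^+ 2)]. *)
Lemma Aeq0_vanish (R : realType) (dxi : R) (a w : int -> R) :
  0 < dxi -> (forall j, 0 <= a j) ->
  (forall s : nat -> int, injective s -> a (s n) @[n --> \oo] --> (1 : R)) ->
  (forall s : nat -> int, injective s -> w (s n) @[n --> \oo] --> 0) ->
  Aeq dxi a w (fun=> 0) -> forall j, w j = 0.
Proof.
move=> h0 a0 a1 w0 [g Hg].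
have dx : dxi != 0 by rewrite gt_eqF.
have Hw j : w (j + 1) = w j + dxi * (a j * g j).
  by have [<- _] := Hg j; rewrite /Dplus; field.
have Hgam j : g j = g (j - 1) + dxi * (a j * w j).
  have [_ /eqP] := Hg j; rewrite subr_eq0 => /eqP ->.
  by rewrite /Dminus; field.
pose x j := g (j - 1) * w j.
have xS j : x (j + 1) = x j + dxi * a j * (w j ^+ 2 + g j ^+ 2).
  by rewrite /x addrK Hw Hgam; ring.
have inc j : 0 <= dxi * a j * (w j ^+ 2 + g j ^+ 2).
  by rewrite mulr_ge0 ?addr_ge0 ?sqr_ge0 // mulr_ge0 // ltW.
have x0 j : x j = 0.
  apply: nondecreasing_int_vanish => [k|s sinj]; first by rewrite xS lerDl.
  (* [g (j - 1)] is recovered as the difference quotient of [w] over [a (j - 1)], which is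
     eventually positive with limit 1; decay of [w] thus gives decay of [x]. *)
  have s'inj : injective (fun n => s n - 1).
    by move=> m n /(congr1 (+%R^~ 1)); rewrite !subrK; exact: sinj.
  have c1 := w0 _ sinj; have c2 := w0 _ s'inj; have c3 := a1 _ s'inj.
  have lim0 : (w (s n) - w (s n - 1)) / dxi / a (s n - 1) * w (s n)
      @[n --> \oo] --> ((0 - 0) / dxi / 1 * 0 : R).
    apply: (cvgM _ c1); apply: cvgM; last by apply: cvgV => //; exact: oner_neq0.
    by apply: cvgM; [exact: cvgB|exact: cvg_cst].
  rewrite mulr0 in lim0; apply: cvg_trans lim0; apply: near_eq_cvg.
  have ane : \forall n \near \oo, 0 < a (s n - 1) by exact: (cvgr_gt _ c3).
  apply: filterS ane => n an; rewrite /x; congr (_ * _).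
  have := Hw (s n - 1); rewrite subrK => ->.
  by field; rewrite dx gt_eqF.
(* A zero increment means [a j = 0] or [w j = g j = 0]; either way [a j * g j = 0], so [w] is
   constant. *)
have wc j : w (j + 1) = w j.
  have := xS j; rewrite !x0 add0r => /esym/eqP; rewrite mulf_eq0 mulf_eq0 (negPf dx) /=.
  rewrite Hw => /orP[/eqP ->|]; first by rewrite mul0r mulr0 addr0.
  rewrite paddr_eq0 ?sqr_ge0 // !sqrf_eq0 => /andP[_ /eqP ->].
  by rewrite !mulr0 addr0.
by apply: nondecreasing_int_vanish => // j; rewrite wc.
Qed.

(** * Existence by gluing at the source *)

(* On each side of [i] the solution is a multiple of the decaying one; their
   common value at [i] is fixed by the jump of [gamma]. *)
Lemma Green_exists (R : realType) (dxi : R) (a : int -> R) (i : int) :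
  0 < dxi -> (forall j, 0 <= a j) ->
  (forall s : nat -> int, injective s -> a (s n) @[n --> \oo] --> (1 : R)) ->
  exists g : int -> R,
    ell2 dxi g /\ Aeq dxi a g (fun j => (i == j)%:R / dxi).
Proof.
move=> h0 a0 a1.
have dx : dxi != 0 by rewrite gt_eqF.
have ha0 j : 0 <= dxi * a j by rewrite mulr_ge0 // ltW.
have ev (s : nat -> int) : injective s ->
    exists N, forall n, (N <= n)%N -> dxi / 2 <= dxi * a (s n).
  move=> /a1 c; have : \forall n \near \oo, 2^-1 <= a (s n).
    by apply: (cvgr_ge _ c); rewrite invf_lt1 ?ltr1n.
  by case=> N _ HN; exists N => n /HN /= ?; rewrite ler_pM2l.
have e0 : 0 < dxi / 2 by rewrite divr_gt0.
have [N1 HN1] := ev (fun n : nat => i + n%:Z) ltac:(move=> m n; lia).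
have [N2 HN2] := ev (fun n : nat => i - n.+1%:Z) ltac:(move=> m n; lia).
(* To the right, [u k] and [- v k] are the unscaled values of [g] and [gam] at [i + k]; updating
   [gam] uses the coefficient at the next site, hence the shift in the second sequence. *)
have [u [v [u0 v0 Hu Hv [M HM]]]] :=
  @half_line_solution R (fun k => dxi * a (i + k%:Z))
    (fun k => dxi * a (i + k.+1%:Z)) _ N1 (fun k => ha0 _) (fun k => ha0 _) e0 HN1
    (fun k le => HN1 k.+1 (leqW le)).
(* To the left, [u' k] sits at [i - k] but [v' k] at [i - k.+1], so both updates use the same
   coefficient. *)
have [u' [v' [u'0 v'0 Hu' Hv' [M' HM']]]] :=
  @half_line_solution R (fun k => dxi * a (i - k.+1%:Z))
    (fun k => dxi * a (i - k.+1%:Z)) _ N2 (fun k => ha0 _) (fun k => ha0 _) e0 HN2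
    HN2.
(* The equation at [i], with [g i = t], [gam i = - (t * v 0)] and [gam (i - 1) = t * v' 0], reads
   [t * (dxi * a i + v 0 + v' 0) = 1]. *)
pose t := (dxi * a i + v 0%N + v' 0%N)^-1.
have t0 : dxi * a i + v 0%N + v' 0%N != 0.
  by rewrite gt_eqF // addr_gt0 // ltr_wpDl.
pose g j := t * match j - i with Posz k => u k | Negz k => u' k.+1 end.
pose gam j := t * match j - i with Posz k => - v k | Negz k => v' k end.
have gP (k : nat) : g (i + k%:Z) = t * u k by rewrite /g addrAC subrr add0r.
have gN (k : nat) : g (i - k%:Z) = t * u' k.
  by rewrite /g addrAC subrr add0r; case: k => [|k] //=; rewrite u0 u'0.
have gamP (k : nat) : gam (i + k%:Z) = - (t * v k).
  by rewrite /gam addrAC subrr add0r mulrN.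
have gamN (k : nat) : gam (i - k.+1%:Z) = t * v' k.
  by rewrite /gam addrAC subrr add0r.
exists g; split.
  apply: (@ell2_two_sided _ _ _ i (t ^+ 2 * M) (t ^+ 2 * M')) => // n.
    under eq_bigr do rewrite gP exprMn.
    by rewrite -mulr_sumr ler_wpM2l ?sqr_ge0.
  under eq_bigr do rewrite gN exprMn.
  rewrite -mulr_sumr ler_wpM2l ?sqr_ge0 // (le_trans _ (HM' n.+1)) //.
  by rewrite big_nat_recl //= lerDr sqr_ge0.
exists gam => j; rewrite /Dplus /Dminus.
have [[k ->]|[k ->]] : (exists k : nat, j = i + k%:Z) \/ (exists k : nat, j = i - k.+1%:Z).
  have [le|lt] := lerP i j; [left; exists `|j - i|%N|right; exists `|j - i|.-1%N]; lia.
- have -> : i + k%:Z + 1 = i + k.+1%:Z by lia.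
  rewrite !gP gamP Hu; split; first by field.
  case: k => [|k].
    have -> : i + 0%:Z - 1 = i - 1%:Z by lia.
    rewrite addr0 gamN eqxx u0.
    have E : t * (dxi * a i + v 0%N + v' 0%N) = 1 by rewrite mulVf.
    by rewrite -[1%:R]E; field.
  have -> : i + k.+1%:Z - 1 = i + k%:Z by lia.
  have -> : (i == i + k.+1%:Z) = false by lia.
  by rewrite gamP Hv mul0r; field.
- have -> : i - k.+1%:Z + 1 = i - k%:Z by lia.
  have -> : i - k.+1%:Z - 1 = i - k.+2%:Z by lia.
  have -> : (i == i - k.+1%:Z) = false by lia.
  rewrite !gN !gamN Hv' mul0r.
  split; [rewrite Hu'|]; by field.
Qed.

Unset Implicit Arguments.

Theorem theorem3p4 (R : realType) (dxi : R) (hdxi : 0 < dxi)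
    (a b : int -> R)
    (ha0 : forall j : int, 0 <= a j)
    (hab : forall j : int, a j = 1 + Dplus dxi b j)
    (hb : ell2 dxi (Dplus dxi b))
    (i : int) :
  exists! g : int -> R,
    ell2 dxi g /\ Aeq dxi a g (fun j => (i == j)%:R / dxi).
Proof.
have a1 (s : nat -> int) : injective s -> a (s n) @[n --> \oo] --> (1 : R).
  move=> sinj; under eq_fun do rewrite hab.
  have : 1 + Dplus dxi b (s n) @[n --> \oo] --> (1 + 0 : R).
    by apply: cvgD; [exact: cvg_cst|exact: ell2_cvg0 hdxi hb sinj].
  by rewrite addr0.
have [g [g2 geq]] := Green_exists i hdxi ha0 a1.
exists g; split=> [//|g' [g'2 g'eq]]; apply/funext => j.
apply/eqP; rewrite -subr_eq0; apply/eqP.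
(* By linearity the difference of two solutions solves the homogeneous system, with the difference
   of their auxiliary sequences. *)
apply: (@Aeq0_vanish _ dxi a (fun j => g j - g' j)) => //.
  move=> s sinj.
  have : g (s n) - g' (s n) @[n --> \oo] --> (0 - 0 : R).
    by apply: cvgB; exact: ell2_cvg0 hdxi _ sinj.
  by rewrite subr0.
have [[c Hc] [c' Hc']] := (geq, g'eq).
exists (fun j => c j - c' j) => k; have [E1 E2] := Hc k; have [E1' E2'] := Hc' k.
split.
  by rewrite mulrBr -E1 -E1' /Dplus -mulrBl; congr (_ / _); ring.
by rewrite -(subrr ((i == k)%:R / dxi)) -{1}E2 -E2' /Dminus; ring.
Qed.
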